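(* For every prime $p$, $\chi(\mathrm{KSh}_p(n,k))\to\infty$ as $n-pk\to\infty$. In other words, for every prime $p$ and every $r\in\mathbb{N}$ there is a (least) constant $C(p,r)$, depending only on $p$ and $r$, such that whenever $n-pk\ge C(p,r)$, for every $r$-coloring $c$ of the vertices of $\mathrm{KSh}_p(n,k)$ there are pairwise disjoint sets $A_1,\ldots,A_p\in\binom{[n]}{k}$ for which $c(A_1,\ldots,A_{p-1})=c(A_2,\ldots,A_p)$.
   Context: Here $[n]=\{1,\dots,n\}$, $\binom{[n]}{k}$ is the family of $k$-element subsets of $[n]$ ($n,k$ positive integers), and $\chi$ denotes chromatic number. For an integer $p\ge2$, the Kneser-shift graph $\mathrm{KSh}_p(n,k)$ has as vertices the ordered $(p-1)$-tuples $(A_1,\ldots,A_{p-1})$ of pairwise disjoint members of $\binom{[n]}{k}$, and has an edge between $(A_1,\ldots,A_{p-1})$ and $(A_2,\ldots,A_p)$ whenever $A_1,\ldots,A_p\in\binom{[n]}{k}$ are all pairwise disjoint. *)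

(* Defs.v *)
From mathcomp Require Import all_boot.

Set Implicit Arguments.
Unset Strict Implicit.
Unset Printing Implicit Defensive.

Record sgraph := SGraph {
  vertex :> finType;
  edge : rel vertex;
  edge_sym : symmetric edge;
  edge_irrefl : irreflexive edge }.

Definition colorable (G : sgraph) (r : nat) : bool :=
  [exists c : {ffun G -> 'I_r},
    [forall u, forall v, edge u v ==> (c u != c v)]].

Lemma colorable_card (G : sgraph) : exists r, colorable G r.
Proof.
exists #|G|; apply/existsP; exists [ffun x => enum_rank x].
apply/forallP=> u; apply/forallP=> v; apply/implyP=> euv; rewrite !ffunE.
by apply: contraTneq euv => /enum_rank_inj ->; rewrite edge_irrefl.
Qed.

Definition chromatic_number (G : sgraph) : nat := ex_minn (colorable_card G).

Definition least (P : nat -> Prop) (m : nat) : Prop :=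
  P m /\ forall m', P m' -> m <= m'.

(* [pairwise] compares positions, so repeated sets are excluded when k > 0. *)
Definition is_disj_tuple (n k : nat) (s : seq {set 'I_n}) : bool :=
  all (fun B : {set 'I_n} => #|B| == k) s
  && pairwise (fun B C : {set 'I_n} => [disjoint B & C]) s.

Definition disj_tuple (m n k : nat) : Type :=
  {A : m.-tuple {set 'I_n} | is_disj_tuple k A}.

Section Shift.
Variables (p n k : nat).
Implicit Type A : disj_tuple p n k.

Fact init_size A : size (take p.-1 (val A)) == p.-1.
Proof. by rewrite size_takel // size_tuple leq_pred. Qed.

Fact init_disj A : is_disj_tuple k (Tuple (init_size A)).
Proof.
have /andP[cA dA] := valP A; apply/andP; split=> /=.
  by apply/allP=> B /mem_take BA; apply: (allP cA).
exact: subseq_pairwise (take_subseq _ _) dA.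
Qed.

Fact tail_disj A : is_disj_tuple k (behead_tuple (val A)).
Proof.
have /andP[cA dA] := valP A; rewrite -[X in is_disj_tuple k X]/(behead (val A)).
rewrite -drop1; apply/andP; split.
  by apply/allP=> B /mem_drop BA; apply: (allP cA).
exact: subseq_pairwise (drop_subseq _ _) dA.
Qed.

(* (A_1, ..., A_p) |-> (A_1, ..., A_{p-1}) *)
Definition init_tuple A : disj_tuple p.-1 n k :=
  exist (fun B => is_disj_tuple k (val B)) (Tuple (init_size A)) (init_disj A).

(* (A_1, ..., A_p) |-> (A_2, ..., A_p) *)
Definition tail_tuple A : disj_tuple p.-1 n k :=
  exist (fun B => is_disj_tuple k (val B)) (behead_tuple (val A)) (tail_disj A).

Definition KSh_edge : rel (disj_tuple p.-1 n k) := fun u v =>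
  [exists A : disj_tuple p n k,
     ((u == init_tuple A) && (v == tail_tuple A))
  || ((v == init_tuple A) && (u == tail_tuple A))].

Lemma KSh_edge_sym : symmetric KSh_edge.
Proof. by move=> u v; apply: eq_existsb => A; rewrite orbC. Qed.

Lemma init_neq_tail A : 1 < p -> 0 < k -> init_tuple A != tail_tuple A.
Proof.
move=> p1 k0; apply/eqP=> /(congr1 (fun t => tval (val t))) /=.
have /andP[] := valP A; have := size_tuple (val A).
case: (tval (val A)) => [|B [|C s]] /= szA; try by move: p1; rewrite -szA.
case/andP=> cB _ /andP[/andP[dBC _] _].
rewrite -szA /= => -[eBC _]; move: dBC cB; rewrite -eBC -setI_eq0 setIid.
by move/eqP->; rewrite cards0 => /eqP k_0; rewrite -k_0 in k0.
Qed.

Hypotheses (p_gt1 : 1 < p) (k_gt0 : 0 < k).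

Lemma KSh_edge_irrefl : irreflexive KSh_edge.
Proof.
move=> u; apply/existsP=> -[A]; rewrite orbb => /andP[/eqP-> /eqP e].
by have := init_neq_tail A p_gt1 k_gt0; rewrite -e eqxx.
Qed.

Definition KSh : sgraph := SGraph KSh_edge_sym KSh_edge_irrefl.

End Shift.

Arguments KSh {p} n {k} p_gt1 k_gt0.

(* Main.v *)
Require Import Defs.
From mathcomp Require Import all_boot all_algebra.
From mathcomp Require Import ring zify.
From Stdlib Require Import Classical_Prop.

(** Suppose that c is an r-coloring with c(A_1..A_{p-1}) <> c(A_2..A_p)
    for all pairwise disjoint k-sets A_1, ..., A_p.

    Step 1: from sets to blocks. For disjoint blocks B_1, ..., B_{p-1} the
    iterated color set ([spectrum])
      { { ... { c(A_1..A_{p-1}) | A_{p-1} in B_{p-1} } ... } | A_1 in B_1 },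
    with A_i ranging over the k-subsets of B_i, takes a number of values
    bounded in terms of p and r only. The vectors x : [n] -> Z_p + {None}
    encode the p-tuples of disjoint blocks; they are ordered by blockwise
    inclusion, and Z_p permutes the blocks cyclically. Writing f(x) for the
    iterated color set of the first p - 1 blocks of x, the property of c
    survives the iteration ([spectrum_proper], [fcol_turn]):
    f(x) <> f(g y) whenever y <= x and all the blocks of y have at least k
    elements. Hence the set F(x) of all f(y) with such y <= x is monotone
    in x, and F(x) <> F(g x) if all the blocks of x have at least k elements.

    Step 2: few heights. To every nonzero vector x, attach the sum over i of
    min(|B_i|, k) + |F(g^i x)|. This height is monotone, has at most
    p k + p R values, where R is the number of iterated color sets. The same
    data form a cyclic word of length p ([word]), which is not constant, and
    which is the same for comparable vectors of equal height. As p is prime,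
    the rotation acts freely on nonconstant words, which therefore carry an
    equivariant sign in Z_p ([equivariant_sign]). Thus comparable vectors of
    equal height have the same sign.

    Step 3: a Tucker-type lemma ([alternating_chain]). Every equivariant
    sign on the nonzero vectors admits a chain x_1 <= ... <= x_n along which
    consecutive signs differ. The heights increase strictly along this
    chain, so n <= p k + p R: this bounds n - p k for a given r.

    The lemma of step 3 is proved by evaluating cochains mod p. Cochains are
    functions on lists, [cobd] is the coboundary, and [integ i] evaluates a
    cochain on an i-chain sigma_i of vectors supported on the first i + 1
    coordinates such that the boundary of sigma_i is (g - 1) sigma_{i-1} for
    i odd, and (1 + g + ... + g^(p-1)) sigma_{i-1} for i even; sigma_i is a
    cone over this boundary. On the side of the signs, the cochain [carry]
    satisfies the dual relations ([cobd_carry]). Therefore the sum over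
    Z_p of carry on the translates of sigma_i is the same for all i, namely 1
    ([integ_Phi]), and carry vanishes on lists with two equal neighbors. *)

Set Implicit Arguments.
Unset Strict Implicit.
Unset Printing Implicit Defensive.

Import GRing.Theory.

(** * Coboundaries and cones *)

Section Coboundary.
Local Open Scope ring_scope.
Variable R : comNzRingType.

(** The augmented simplicial coboundary: the alternating sum of phi over the
    faces of the list l. A cochain is a function on lists of all lengths at
    once, and the empty list is the face of dimension -1. *)
Fixpoint cobd (T : Type) (phi : seq T -> R) (l : seq T) {struct l} : R :=
  if l is x :: l' then phi l' - cobd (fun z => phi (x :: z)) l' else 0.

Lemma cobdB (T : Type) (phi psi : seq T -> R) l :
  cobd (fun z => phi z - psi z) l = cobd phi l - cobd psi l.
Proof.
elim: l phi psi => /= [|x l IHl] phi psi; first by rewrite subr0.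
by rewrite IHl; ring.
Qed.

Lemma cobdM (T : Type) a (phi : seq T -> R) l :
  cobd (fun z => a * phi z) l = a * cobd phi l.
Proof.
elim: l phi => /= [|x l IHl] phi; first by rewrite mulr0.
by rewrite IHl; ring.
Qed.

Lemma cobd_sum (T : Type) m (phi : 'I_m -> seq T -> R) l :
  cobd (fun z => \sum_(j < m) phi j z) l = \sum_(j < m) cobd (phi j) l.
Proof.
elim: l phi => /= [|x l IHl] phi; first by rewrite big1.
by rewrite IHl -sumrB.
Qed.

Lemma cobd_map (S T : Type) (f : S -> T) (phi : seq T -> R) l :
  cobd (fun z => phi (map f z)) l = cobd phi (map f l).
Proof. by elim: l phi => //= x l IHl phi; rewrite (IHl (fun z => phi (f x :: z))). Qed.

Section Cone.
Variables (T : Type) (f : T -> T) (v : T).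
Implicit Types (phi psi : seq T -> R) (l : seq T).

(** Evaluation of phi on the prism between l and [map f l]:
    the alternating sum of phi [:: x_0; ...; x_i; f x_i; ...; f x_m]. *)
Fixpoint prism phi l {struct l} : R :=
  if l is x :: l' then phi (x :: map f l) - prism (fun z => phi (x :: z)) l'
  else 0.

(** Evaluation of phi on the cone over l with apex v, where l is first
    deformed to [map f l]. *)
Definition cone phi l : R := phi (v :: map f l) - prism phi l.

Lemma eq_prism phi psi l :
    (forall l1 x l2, l = l1 ++ x :: l2 ->
       phi (l1 ++ x :: map f (x :: l2)) = psi (l1 ++ x :: map f (x :: l2))) ->
  prism phi l = prism psi l.
Proof.
elim: l phi psi => //= x l IHl phi psi eqp.
rewrite (eqp [::] x l erefl) (IHl _ (fun z => psi (x :: z))) //.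
by move=> l1 y l2 el; apply: (eqp (x :: l1)); rewrite el.
Qed.

Lemma prismB phi psi l :
  prism (fun z => phi z - psi z) l = prism phi l - prism psi l.
Proof.
elim: l phi psi => /= [|x l IHl] phi psi; first by rewrite subr0.
by rewrite IHl; ring.
Qed.

Lemma prism_cobd phi l :
  prism (cobd phi) l + cobd (prism phi) l = phi (map f l) - phi l.
Proof.
elim: l phi => /= [|x l IHl] phi; first by rewrite subrr addr0.
rewrite (prismB phi) (cobdB (fun z => phi [:: x, f x & map f z])).
rewrite (cobd_map f (fun z => phi [:: x, f x & z])).
have /(canRL (addrK _)) -> := IHl (fun z => phi (x :: z)).
ring.
Qed.

(** Coning is a contraction of the augmented cochain complex. The augmentation
    makes this hold in all degrees, including that of the empty list. *)
Lemma cone_homotopy phi l : cone (cobd phi) l + cobd (cone phi) l = phi l.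
Proof.
rewrite /cone cobdB /= (cobd_map f (fun z => phi (v :: z))).
have /(canRL (addrK _)) -> := prism_cobd phi l.
ring.
Qed.

End Cone.
End Coboundary.

(** * The cyclic shift and the carry cochain *)

Lemma val_iter_ord_pred p (a : 'I_p) j :
  j <= p -> iter j (@ord_pred p) a = (a + (p - j)) %% p :> nat.
Proof.
elim: j => [|j IHj] jp /=; first by rewrite subn0 modnDr modn_small.
rewrite IHj ?(ltnW jp) //.
have [e|ne] := eqVneq ((a + (p - j)) %% p) 0.
  rewrite e add0n modn_small; last by rewrite prednK //; lia.
  apply/eqP; rewrite -(modn_small (_ : p.-1 < p)); last by lia.
  rewrite -(eqn_modDr 1) addn1 prednK; last by lia.
  by rewrite modnn -addnA addn1 -subSn // subSS e.
have -> : ((a + (p - j)) %% p + p).-1 = ((a + (p - j)) %% p).-1 + p by lia.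
rewrite modnDr modn_small; last by have := ltn_pmod (a + (p - j)) (_ : 0 < p); lia.
apply/eqP; rewrite -(modn_small (_ : ((a + (p - j)) %% p).-1 < p)); last first.
  by have := ltn_pmod (a + (p - j)) (_ : 0 < p); lia.
rewrite -(eqn_modDr 1) addn1 prednK ?lt0n //.
by rewrite modn_mod -addnA addn1 -subSn // subSS.
Qed.

Lemma iter_ord_pred_id p (a : 'I_p) : iter p (@ord_pred p) a = a.
Proof. by apply: ord_inj; rewrite val_iter_ord_pred // subnn addn0 modn_small. Qed.

Lemma iter_ord_pred_eq0 p (a j : 'I_p) :
  (iter j (@ord_pred p) a == 0%N :> nat) = (j == a).
Proof.
rewrite val_iter_ord_pred 1?ltnW // -[0](mod0n p).
rewrite -(eqn_modDr j) -addnA subnK 1?ltnW // modnDr add0n !modn_small //.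
by rewrite eq_sym.
Qed.

Section Carry.
Local Open Scope ring_scope.
Variables (p : nat) (R : comNzRingType).
Notation shift := (@ord_pred p).

(** The coboundary of the indicator of a < b. It is invariant under the cyclic
    shift ([wrap_shift]), although the indicator itself is not. *)
Definition wrap (a b c : 'I_p) : R :=
  (b < c)%N%:R - (a < c)%N%:R + (a < b)%N%:R.

(** The cochains [a = 0] and [a < b] in degrees 0 and 1, multiplied in front by
    copies of the 2-cocycle [wrap] to reach all degrees; the value on the empty
    list is the augmentation. *)
Fixpoint carry (l : seq 'I_p) : R :=
  if l is a :: l1 then
    if l1 is b :: l2 then
      if l2 is c :: _ then wrap a b c * carry l2 else (a < b)%N%:R
    else (a == 0%N :> nat)%:R
  else 1.

(** The two operators of the periodic resolution of a cyclic group of order p,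
    acting on cochains: g - 1 if b holds, and the norm
    1 + g + ... + g^(p-1) otherwise. *)
Definition cyc_op (T : Type) (g : T -> T) (b : bool) (phi : seq T -> R) l : R :=
  if b then phi (map g l) - phi l
  else \sum_(j < p) phi (map (iter j g) l).

(** The indicator of a < b changes under the shift by the coboundary of the
    indicator of 0. *)
Lemma ltn_shift (a b : 'I_p) :
  (shift a < shift b)%N%:R - (a < b)%N%:R
    = (b == 0%N :> nat)%:R - (a == 0%N :> nat)%:R :> R.
Proof.
have E (i : 'I_p) : shift i = (if i == 0%N :> nat then p.-1 else i.-1) :> nat.
  rewrite /=; case: eqP => i0; first by rewrite i0 modn_small //; have := ltn_ord i; lia.
  have -> : ((i + p).-1 = i.-1 + p)%N by lia.
  by rewrite modnDr modn_small //; have := ltn_ord i; lia.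
rewrite !E; have := ltn_ord a; have := ltn_ord b.
case: (eqVneq (a : nat) 0%N) => [->|a0]; case: (eqVneq (b : nat) 0%N) => [->|b0] b_p a_p.
- by rewrite !ltnn !subrr.
- by rewrite ltnNge (_ : b.-1 <= p.-1)%N ?lt0n ?b0 ?sub0r ?mulr0n ?sub0r //; lia.
- by rewrite (_ : (a.-1 < p.-1)%N) ?ltn0 ?subr0 //; lia.
- by rewrite (_ : (a.-1 < b.-1)%N = (a < b)%N) ?subrr //; lia.
Qed.

Lemma wrap_shift a b c : wrap (shift a) (shift b) (shift c) = wrap a b c.
Proof.
have E x y : (shift x < shift y)%N%:R
   = (x < y)%N%:R + ((y == 0%N :> nat)%:R - (x == 0%N :> nat)%:R) :> R.
  by rewrite -ltn_shift addrC subrK.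
by rewrite /wrap !E; ring.
Qed.

Lemma wrap_iter j a b c :
  wrap (iter j shift a) (iter j shift b) (iter j shift c) = wrap a b c.
Proof. by elim: j => //= j IHj; rewrite wrap_shift. Qed.

(** The coboundary of carry is its image under g - 1 in odd dimensions, and
    under the norm in even dimensions. *)
Lemma cobd_carry l : cobd carry l = cyc_op shift (~~ odd (size l)) carry l.
Proof.
have sum0 (a : 'I_p) : \sum_(j < p) (iter j shift a == 0%N :> nat)%:R = 1 :> R.
  rewrite (bigD1 a) //= iter_ord_pred_eq0 eqxx big1 ?addr0 // => j ja.
  by rewrite iter_ord_pred_eq0 (negPf ja).
(* The recursion of carry removes two entries at a time. *)
have [m] := ubnP (size l); elim: m l => // m IHm.
case=> [|a [|b [|c [|d l]]]] szl.
- by rewrite /cyc_op /= subrr.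
- by rewrite /cyc_op /= subr0 sum0.
- by rewrite /cyc_op /= subr0 ltn_shift.
- have E j : carry (map (iter j shift) [:: a; b; c])
      = wrap a b c * (iter j shift c == 0%N :> nat)%:R by rewrite /= wrap_iter.
  rewrite /cyc_op /= -[RHS]/(\sum_(j < p) carry (map (iter j shift) [:: a; b; c])).
  by under eq_bigr do rewrite E; rewrite -mulr_sumr sum0 /wrap; ring.
have -> : cobd carry [:: a, b, c, d & l]
    = (wrap b c d - wrap a c d + wrap a b d - wrap a b c) * carry (d :: l)
        + wrap a b c * cobd carry [:: c, d & l].
  rewrite [cobd carry (c :: d :: l)](_ : _ =
    carry (d :: l) - cobd (fun z => carry (c :: z)) (d :: l)) //.
  rewrite [LHS](_ : _ = wrap b c d * carry (d :: l) - (wrap a c d * carry (d :: l)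
    - (wrap a b d * carry (d :: l)
       - cobd (fun z => wrap a b c * carry (c :: z)) (d :: l)))) //.
  by rewrite cobdM; ring.
rewrite IHm; last by move: szl => /=; lia.
(* wrap is a cocycle, being a coboundary *)
have -> : wrap b c d - wrap a c d + wrap a b d - wrap a b c = 0 by rewrite /wrap; ring.
rewrite mul0r add0r /= !negbK /cyc_op; case: (odd _).
  rewrite mulr_sumr; apply: eq_bigr => j _.
  by rewrite [in RHS]map_cons [in RHS]map_cons [in RHS]map_cons /= wrap_iter.
rewrite mulrBr; congr (_ - _).
by rewrite [in RHS]map_cons [in RHS]map_cons [in RHS]map_cons /= wrap_shift.
Qed.

Lemma carry_neq0 l : carry l != 0 -> sorted (fun a b : 'I_p => a != b) l.
Proof.
have [m] := ubnP (size l); elim: m l => // m IHm.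
case=> [|a [|b [|c l]]] // szl.
  by rewrite /= andbT; apply: contra_neqN => /eqP->; rewrite ltnn.
rewrite [carry _]/= -/(carry (c :: l)) => nz /=.
have ab : a != b.
  apply: contraNneq nz => ->; rewrite /wrap ltnn addr0 subrr.
  by rewrite mul0r.
have bc : b != c.
  apply: contraNneq nz => ->; rewrite /wrap ltnn sub0r addNr.
  by rewrite mul0r.
rewrite ab bc /=; apply: (IHm (c :: l)); first by move: szl => /=; lia.
by apply: contraNneq nz => ->; rewrite mulr0.
Qed.

End Carry.

(** * Chains with alternating signs *)

(** The setting of the Tucker-type lemma, stated without reference to vectors:
    [D i] is the domain of the objects with support in the first i coordinates,
    f i adds the coordinate i to an object, and v i is supported on the
    coordinate i alone. Thus x <= f i x >= v i contracts [D i] inside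
    [D i.+1]. *)
Section AlternatingChain.
Local Open Scope ring_scope.
Variables (p : nat) (R : comNzRingType).
Variables (T : Type) (le : rel T) (D : nat -> pred T) (n : nat).
Variables (g : T -> T) (f : nat -> T -> T) (v : nat -> T) (s : T -> 'I_p).
Implicit Types (phi psi : seq T -> R) (l : seq T).

Hypothesis p0 : p%:R = 0 :> R.
Hypothesis g_iter : forall x, iter p g x = x.
Hypothesis g_mono : forall x y, le x y -> le (g x) (g y).
Hypothesis g_D : forall i x, D i x -> D i (g x).
Hypothesis f_ge : forall i x, D i x -> le x (f i x).
Hypothesis f_mono : forall i x y, le x y -> le (f i x) (f i y).
Hypothesis v_le : forall i x, D i x -> le (v i) (f i x).
Hypothesis D_S : forall i x, D i x -> D i.+1 x.
Hypothesis f_D : forall i x, (i < n)%N -> D i x -> D i.+1 (f i x).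
Hypothesis v_D : forall i, (i < n)%N -> D i.+1 (v i).
Hypothesis s_g : forall i x, D i x -> s (g x) = ord_pred (s x).

(** A weakly increasing list of length i in the domain [D i]. *)
Definition chain i l := [&& size l == i, sorted le l & all (D i) l].

Lemma chain_g i l : chain i l -> chain i (map g l).
Proof.
case/and3P=> szl lel Dl; rewrite /chain size_map szl /=; apply/andP; split.
  by apply: (homo_sorted g_mono).
by rewrite all_map; apply: sub_all Dl => x; apply: g_D.
Qed.

Lemma chain_iter_g i j l : chain i l -> chain i (map (iter j g) l).
Proof.
elim: j l => [|j IHj] l cl; first by rewrite map_id.
have -> : map (iter j.+1 g) l = map g (map (iter j g) l) by rewrite -map_comp.
exact/chain_g/IHj.
Qed.

(** The cone over a chain of [D i] involves only chains of [D i.+1]. *)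
Lemma cone_eq_chain i phi psi : (i < n)%N ->
    (forall l, chain i.+1 l -> phi l = psi l) ->
  forall l, chain i l -> cone (f i) (v i) phi l = cone (f i) (v i) psi l.
Proof.
move=> ltin eqp l /and3P[/eqP szl lel Dl]; congr (_ - _).
  apply: eqp; apply/and3P; split.
  - by rewrite /= size_map szl.
  - have: sorted le (map (f i) l) by apply: homo_sorted lel; apply: f_mono.
    by case: (l) Dl => //= x l' /andP[Dx _] ->; rewrite v_le.
  rewrite /= v_D // all_map; apply: sub_all Dl => x; exact: f_D.
apply: eq_prism => l1 x l2 el; apply: eqp.
move: szl lel Dl; rewrite {}el size_cat sorted_cat_cons all_cat /=.
move=> szl /andP[le1 le2] /and3P[D1 Dx D2]; apply/and3P; split.
- by rewrite size_cat /= size_map -szl addnS.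
- rewrite sorted_cat_cons le1 /= f_ge //=.
  by apply: (homo_path (e := le)) le2; apply: f_mono.
rewrite all_cat /= D_S // f_D // (sub_all (@D_S i)) //= all_map.
by apply: sub_all D2 => y; apply: f_D.
Qed.

Lemma cyc_op_eq_chain b i phi psi :
    (forall l, chain i l -> phi l = psi l) ->
  forall l, chain i l -> cyc_op p g b phi l = cyc_op p g b psi l.
Proof.
move=> eqp l cl; rewrite /cyc_op; case: b; first by rewrite !eqp ?chain_g.
by apply: eq_bigr => j _; rewrite eqp ?chain_iter_g.
Qed.

Lemma cyc_opB b phi psi l :
  cyc_op p g b (fun z => phi z - psi z) l = cyc_op p g b phi l - cyc_op p g b psi l.
Proof. by case: b => /=; [ring | rewrite sumrB]. Qed.

Lemma coneB h w phi psi (l : seq T) :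
  cone h w (fun z => phi z - psi z) l = cone h w phi l - cone h w psi l.
Proof. by rewrite /cone prismB; ring. Qed.

Lemma cobd_cyc_op b phi l : cobd (cyc_op p g b phi) l = cyc_op p g b (cobd phi) l.
Proof.
case: b; rewrite /cyc_op.
  by rewrite cobdB (cobd_map g).
by rewrite cobd_sum; apply: eq_bigr => j _; rewrite cobd_map.
Qed.

(** The operators g - 1 and the norm annihilate each other, as g^p = 1. *)
Lemma cyc_op_cyc_op b phi l : cyc_op p g b (cyc_op p g (~~ b) phi) l = 0.
Proof.
have tele : \sum_(j < p) (phi (map (iter j.+1 g) l) - phi (map (iter j g) l)) = 0.
  rewrite -(big_mkord xpredT (fun j => phi (map (iter j.+1 g) l) - phi (map (iter j g) l))).
  rewrite (telescope_sumr (fun j => phi (map (iter j g) l))) //.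
  by rewrite map_id (eq_map g_iter) map_id subrr.
rewrite -[RHS]tele; case: b => /=.
  rewrite -sumrB; apply: eq_bigr => j _; congr (phi _ - phi _).
  by rewrite -map_comp; apply: eq_map => x /=; rewrite -iterSr.
by apply: eq_bigr => j _; congr (phi _ - phi _); rewrite -map_comp.
Qed.

(** Evaluation of a cochain on the chain sigma_i, where sigma_0 is the point
    v 0, and sigma_i is the cone with apex v i over the image of sigma_{i-1}
    under g - 1 for i odd, under the norm for i even. *)
Fixpoint integ i phi : R :=
  if i is j.+1 then integ j (cyc_op p g (odd i) (cone (f i) (v i) phi))
  else cone (f 0) (v 0) phi [::].

Lemma integ_eq i phi psi : (i < n)%N ->
  (forall l, chain i.+1 l -> phi l = psi l) -> integ i phi = integ i psi.
Proof.
elim: i phi psi => [|i IHi] phi psi ltin eqp /=.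
  exact: (cone_eq_chain ltin eqp).
apply: IHi; first exact: ltnW.
by apply: cyc_op_eq_chain; apply: cone_eq_chain.
Qed.

Lemma eq_integ i phi psi : phi =1 psi -> integ i phi = integ i psi.
Proof.
elim: i phi psi => [|i IHi] phi psi eqp /=.
  by rewrite /cone /= eqp.
apply: IHi => l; rewrite /cyc_op.
have E z : cone (f i.+1) (v i.+1) phi z = cone (f i.+1) (v i.+1) psi z.
  by rewrite /cone eqp; congr (_ - _); apply: eq_prism.
by case: ifP => _; [rewrite !E | apply: eq_bigr].
Qed.

Lemma integB i phi psi :
  integ i (fun z => phi z - psi z) = integ i phi - integ i psi.
Proof.
elim: i phi psi => [|i IHi] phi psi /=; first by rewrite coneB.
rewrite -IHi; apply: eq_integ => l.
rewrite -cyc_opB; rewrite /cyc_op; case: ifP => _; first by rewrite !coneB.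
by apply: eq_bigr => j _; rewrite coneB.
Qed.

Lemma integ0 i phi : phi =1 (fun=> 0) -> integ i phi = 0.
Proof.
move=> phi0; rewrite -(subrr (integ i phi)) -integB; apply: eq_integ => l.
by rewrite phi0 subrr.
Qed.

Lemma integ_sum i m (phi : 'I_m -> seq T -> R) :
  integ i (fun z => \sum_(j < m) phi j z) = \sum_(j < m) integ i (phi j).
Proof.
elim: m phi => [|m IHm] phi.
  by rewrite big_ord0; apply: integ0 => l; rewrite big_ord0.
rewrite big_ord_recr /= -IHm.
have -> : integ i (fun z => \sum_(j < m.+1) phi j z)
    = integ i (fun z => \sum_(j < m) phi (widen_ord (leqnSn m) j) z
                        - (0 - phi ord_max z)).
  by apply: eq_integ => z; rewrite big_ord_recr /= sub0r opprK.
by rewrite !integB (@integ0 _ (fun=> 0)) // sub0r opprK.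
Qed.

Lemma integS i phi :
  integ i.+1 phi = integ i (cyc_op p g (odd i.+1) (cone (f i.+1) (v i.+1) phi)).
Proof. by []. Qed.

Lemma integ_cone_cobd i b h w phi :
  integ i (cyc_op p g b (cone h w (cobd phi)))
    = integ i (cyc_op p g b phi) - integ i (cobd (cyc_op p g b (cone h w phi))).
Proof.
rewrite -integB; apply: eq_integ => l; rewrite cobd_cyc_op -cyc_opB /cyc_op.
have E z : cone h w (cobd phi) z = phi z - cobd (cone h w phi) z.
  by rewrite -[phi z](cone_homotopy h w) addrK.
case: ifP => _; first by rewrite !E.
by apply: eq_bigr => j _; rewrite E.
Qed.

(** Stokes: the boundary of sigma_{i+1} is the image of sigma_i under g - 1 or
    the norm. *)
Lemma integ_cobd i phi :
  integ i.+1 (cobd phi) = integ i (cyc_op p g (odd i.+1) phi).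
Proof.
elim: i phi => [|i IHi] phi; rewrite integS integ_cone_cobd.
  by rewrite [X in _ - X]/= /cone /= /cyc_op /= !subrr !subr0.
rewrite IHi [X in _ - X]integ0 ?subr0 // => l.
exact: (cyc_op_cyc_op (odd i.+1)).
Qed.

(** The carry cochain pulled back along the sign s. *)
Let Phi l := carry R (map s l).

Lemma cobd_Phi i l : chain i l -> cobd Phi l = cyc_op p g (~~ odd i) Phi l.
Proof.
case/and3P=> /eqP szl _ Dl; rewrite /Phi cobd_map cobd_carry size_map szl.
have Es m : map (iter m (@ord_pred p)) (map s l) = map s (map (iter m g) l).
  rewrite -!map_comp; elim: l Dl {szl} => //= x l IHl /andP[Dx /IHl ->].
  congr (_ :: _); elim: m {IHl} => //= m ->; rewrite (@s_g i) //.
  by elim: m => //= m Dm; apply: g_D.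
rewrite /cyc_op; case: ifP => _; first by rewrite (Es 1%N).
by apply: eq_bigr => j _; rewrite Es.
Qed.

(** In even dimensions the norm of Phi is a coboundary, and Stokes lowers the
    dimension. In odd dimensions only (g - 1) Phi is a coboundary: the integrals
    a j and b j of g^j Phi in dimensions i + 1 and i then have the same
    increments, so that their sums over j < p differ by p times a constant,
    which is 0. *)
Lemma integ_Phi i : (i < n)%N -> integ i (cyc_op p g false Phi) = 1.
Proof.
have E j k : (k < n)%N -> integ k (fun l => cobd Phi (map (iter j g) l))
    = integ k (fun l => cyc_op p g (odd k) Phi (map (iter j g) l)).
  move=> ltin; apply: integ_eq => // l cl.
  by rewrite (cobd_Phi (chain_iter_g j cl)) /= negbK.
have E0 k : (k < n)%N -> integ k (cyc_op p g (odd k) Phi) = integ k (cobd Phi).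
  move=> ltin; apply: integ_eq => // l cl.
  by rewrite (cobd_Phi cl) /= negbK.
elim: i => [|i IHi] ltin.
  by rewrite [false]/(odd 0) E0 //= /cone /= !subr0.
have [odd_i|even_i] := boolP (odd i.+1); last first.
  have <- : odd i.+1 = false by apply: negbTE.
  rewrite E0 // integ_cobd (negbTE even_i).
  exact/IHi/ltnW.
rewrite -[RHS](IHi (ltnW ltin)) /cyc_op !integ_sum.
set a := fun j => integ i.+1 (fun z => Phi (map (iter j g) z)).
set b := fun j => integ i (fun z => Phi (map (iter j g) z)).
have ab j : a j.+1 - a j = b j.+1 - b j.
  have S z : map (iter j.+1 g) z = map g (map (iter j g) z) by rewrite -map_comp.
  rewrite /a /b -!integB.
  have -> : integ i.+1 (fun z => Phi (map (iter j.+1 g) z) - Phi (map (iter j g) z))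
          = integ i.+1 (cobd (fun l => Phi (map (iter j g) l))).
    rewrite (eq_integ _ (fun l => cobd_map _ _ l)) E // odd_i.
    by apply: eq_integ => z; rewrite S.
  rewrite integ_cobd odd_i; apply: eq_integ => z; rewrite /cyc_op S.
  by congr (Phi _ - _); rewrite -!map_comp; apply: eq_map => x /=; rewrite -iterSr.
have abj j : a j = b j + (a 0%N - b 0%N).
  elim: j => [|j IHj]; first by rewrite addrC subrK.
  by have := ab j; rewrite IHj => /(canRL (subrK _)) ->; ring.
transitivity (\sum_(j < p) (b j + (a 0%N - b 0%N))).
  by apply: eq_bigr => j _; apply: abj.
by rewrite big_split /= sumr_const card_ord -mulr_natl p0 mul0r addr0.
Qed.

(** Along some chain of length n, any two consecutive signs are different. *)
Lemma alternating_chain : (0 < n)%N ->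
  ~ (forall l, chain n l -> ~~ sorted (fun x y => s x != s y) l).
Proof.
move=> n_gt0 noalt; have n1 : (n.-1 < n)%N by rewrite prednK.
have := integ_Phi n1; rewrite (integ_eq (psi := fun=> 0)) //.
  by rewrite integ0 // => /esym/eqP; rewrite oner_eq0.
rewrite prednK // => l cl; rewrite /cyc_op big1 // => j _.
apply: contraTeq isT => /carry_neq0; rewrite sorted_map => srt.
by have := noalt _ (chain_iter_g j cl); rewrite srt.
Qed.

End AlternatingChain.

(** * Equivariant signs *)

(** An action of the cyclic group of prime order p has orbits of size 1 and p,
    so it can be trivialized equivariantly outside its fixed points: the sign of
    w counts the steps from w to the chosen root of its orbit. *)
Lemma equivariant_sign p (W : finType) (g : W -> W) :
    prime p -> (forall w, iter p g w = w) ->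
  exists sgn : W -> 'I_p, forall w, g w != w -> sgn (g w) = ord_pred (sgn w).
Proof.
move=> p_pr gp; have p_gt0 := prime_gt0 p_pr.
have g_inj : injective g.
  by move=> x y gxy; rewrite -[x]gp -[y]gp -(prednK p_gt0) !iterSr gxy.
have ordp w : g w != w -> order g w = p.
  move=> gw; have o_w := iter_order g_inj w.
  have /eqP : p %% order g w = 0.
    rewrite -(findex_iter (ltn_pmod p (order_gt0 g w))).
    rewrite [iter _ _ _](_ : _ = w); first exact: findex0.
    rewrite -[RHS]gp {2}(divn_eq p (order g w)) addnC iterD; congr iter.
    by elim: (_ %/ _) => //= q IHq; rewrite mulSn iterD -IHq.
  rewrite -/(dvdn _ _) => o_dvd; case/primeP: p_pr => _ /(_ _ o_dvd).
  by case/orP=> /eqP // o1; move: o_w gw; rewrite o1 /= => ->; rewrite eqxx.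
pose idx w := findex g w (froot g w).
exists (fun w => Ordinal (ltn_pmod (idx w) p_gt0)) => w gw; apply: ord_inj => /=.
have ggw : g (g w) != g w by rewrite (inj_eq g_inj).
have rt : froot g (g w) = froot g w.
  apply/esym/eqP; rewrite root_connect; first exact: fconnect1.
  exact: fconnect_sym.
have cw : fconnect g w (froot g w) by apply: connect_root.
have lt_idx : idx w < p by rewrite -(ordp w gw) findex_max.
have it : iter (idx w) g w = froot g w by apply: iter_findex.
rewrite (modn_small lt_idx).
have [i0|i_gt0] := posnP (idx w).
  have -> : idx (g w) = p.-1.
    have last_w : iter p.-1 g (g w) = w by rewrite -iterSr prednK.
    by rewrite /idx rt -it i0 /= -{2}last_w findex_iter // ordp // prednK.
  by rewrite i0.
have -> : idx (g w) = (idx w).-1.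
  rewrite {1}/idx rt -it -[in iter _ _ _](prednK i_gt0) iterSr.
  by rewrite findex_iter // ordp //; lia.
have -> : (idx w + p).-1 = (idx w).-1 + p by lia.
by rewrite modnDr.
Qed.

(** * Iterated color sets *)

(** The j-fold iterated power set of E. *)
Fixpoint iterset (j : nat) (E : finType) : finType :=
  if j is j'.+1 then {set iterset j' E} else E.

Section Spectrum.
Variables (p n k : nat) (E : finType) (col : seq {set 'I_n} -> E).
Implicit Types (L : seq {set 'I_n}) (B : nat -> {set 'I_n}).

(** With m the size of L, the sets
      { ... { col(L, A_m, ..., A_{m+j-1}) | A_{m+j-1} } ... | A_m },
    A_i ranging over the k-subsets of the block B i. *)
Fixpoint spectrum (j : nat) L B : iterset j E :=
  if j is j'.+1 return iterset j E then
    [set spectrum j' (rcons L a) B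
      | a in [set a : {set 'I_n} | (a \subset B (size L)) && (#|a| == k)]]
  else col L.

Lemma eq_spectrum j L B B' :
    (forall i, size L <= i < size L + j -> B i = B' i) ->
  spectrum j L B = spectrum j L B'.
Proof.
elim: j L => //= j IHj L eqB; rewrite (eqB (size L)); last by lia.
apply: eq_imset => a; apply: IHj => i; rewrite size_rcons => /andP[li ui].
by apply: eqB; lia.
Qed.

Hypothesis col_proper : forall L, size L = p -> is_disj_tuple k L ->
  col (take p.-1 L) <> col (behead L).

(** Properness passes from col to its iterated color sets, with blocks B on the
    left, and with the smaller blocks B', shifted by one, on the right. If both
    sides are equal for j + 1, the element of the left side obtained by
    choosing the last set of L is an element of the right side, obtained by
    choosing some a; then both sides are equal for j and the list L
    extended by a. *)
Lemma spectrum_proper j L B B' :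
    (forall i i', i < i' < p -> [disjoint B i & B i']) ->
    (forall i, i < p -> B' i \subset B i) ->
    (forall i, i < p -> k <= #|B' i|) ->
    0 < size L -> size L + j = p ->
    (forall i, i < size L -> nth set0 L i \subset B i) ->
    all (fun a : {set 'I_n} => #|a| == k) L ->
  spectrum j (take (size L).-1 L) B <> spectrum j (behead L) (fun i => B' i.+1).
Proof.
move=> disB subB cardB'; elim: j L => [|j IHj] L L_gt0 szL LB Lk.
  move: szL; rewrite addn0 /= => szL; rewrite szL; apply: col_proper => //.
  apply/andP; split=> //; apply/(pairwiseP set0) => i i'; rewrite !inE => iL i'L ii'.
  apply: disjointWl (LB _ iL) _; apply: disjointWr (LB _ i'L) _.
  by apply: disB; rewrite ii' -szL.
have lt_last : (size L).-1 < size L by rewrite prednK.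
move=> eqS.
have : spectrum j L B \in spectrum j.+1 (take (size L).-1 L) B.
  apply/imsetP; exists (nth set0 L (size L).-1).
    rewrite inE size_take lt_last LB //=.
    by apply: (allP Lk); apply: mem_nth.
  by rewrite -take_nth // prednK // take_size.
rewrite eqS => /imsetP[a]; rewrite inE size_behead prednK // => /andP[aB ak] eqSa.
pose L' := rcons L a.
have bL' : behead L' = rcons (behead L) a by rewrite /L'; case: (L) L_gt0.
have tL' : take (size L').-1 L' = L.
  by rewrite /L' size_rcons /= -cats1 take_size_cat.
have szL' : size L' + j = p by rewrite size_rcons addSnnS.
apply: (IHj L'); rewrite ?tL' ?bL' //.
- by rewrite size_rcons.
- move=> i; rewrite /L' size_rcons nth_rcons ltnS leq_eqVlt.
  case: ltnP => [iL _|Li]; first exact: LB.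
  rewrite orbF => /eqP->; rewrite eqxx.
  by apply: subset_trans aB (subB _ _); lia.
by rewrite all_rcons ak.
Qed.

End Spectrum.

(** * Vectors of disjoint blocks *)

Section Vectors.
Variables (p n k : nat) (p_pr : prime p) (k_gt0 : 0 < k).
Variables (E : finType) (col : seq {set 'I_n} -> E).
Let p_gt0 : 0 < p := prime_gt0 p_pr.
Let z0 : 'I_p := Ordinal p_gt0.
Notation T := {ffun 'I_n -> option 'I_p}.
Notation P := (iterset p.-1 E).
Implicit Types (x y z : T).

Hypothesis col_proper : forall L, size L = p -> is_disj_tuple k L ->
  col (take p.-1 L) <> col (behead L).
Hypothesis n_large : p * k + (p * #|P|).+1 <= n.

(** The i-th block of x. The index i is a natural number, and the block is
    empty for i >= p. *)
Definition block x (i : nat) : {set 'I_n} :=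
  [set j | omap (@nat_of_ord p) (x j) == Some i].

(** Blockwise inclusion. *)
Definition vle x y := [forall j, (x j == None) || (x j == y j)].

(** The cyclic action: the block i of [turn x] is the block i + 1 of x, mod p. *)
Definition turn x : T := [ffun j => omap (@ord_pred p) (x j)].

(** [fill i x] puts the coordinate i into the block 0; [unitv i] has no other
    coordinate. *)
Definition fill i x : T := [ffun j => if val j == i then Some z0 else x j].
Definition unitv i : T := [ffun j => if val j == i then Some z0 else None].
(** Nonzero vectors with support in the first i coordinates. *)
Definition below i x :=
  [exists j, x j != None] && [forall j : 'I_n, (i <= j) ==> (x j == None)].

Lemma vleP x y : reflect (forall j a, x j = Some a -> y j = Some a) (vle x y).
Proof.
apply: (iffP forallP) => [xy j a xj|xy j].
  by have := xy j; rewrite xj /= => /eqP.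
by case xj: (x j) => [a|] //=; rewrite (xy _ _ xj) eqxx.
Qed.

Lemma vle_block x y i : vle x y -> block x i \subset block y i.
Proof.
move=> /vleP xy; apply/subsetP=> j; rewrite !inE.
by case xj: (x j) => [a|] //=; rewrite (xy _ _ xj).
Qed.

Lemma block_disjoint x i i' : i != i' -> [disjoint block x i & block x i'].
Proof.
move=> ii'; rewrite disjoint_subset; apply/subsetP=> j; rewrite !inE => /eqP->.
by apply: contraNneq ii' => -[->].
Qed.

Lemma iter_turn m x j : iter m turn x j = omap (iter m (@ord_pred p)) (x j).
Proof.
elim: m => [|m IHm] /=; first by case: (x j).
by rewrite ffunE IHm; case: (x j).
Qed.

Lemma iter_turn_id x : iter p turn x = x.
Proof.
by apply/ffunP=> j; rewrite iter_turn; case: (x j) => //= a; rewrite iter_ord_pred_id.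
Qed.

Lemma turn_mono x y : vle x y -> vle (turn x) (turn y).
Proof.
move=> /vleP xy; apply/vleP=> j a; rewrite !ffunE.
by case xj: (x j) => [b|] //= ; rewrite (xy _ _ xj).
Qed.

Lemma iter_turn_mono m x y : vle x y -> vle (iter m turn x) (iter m turn y).
Proof. by move=> xy; elim: m => //= m; apply: turn_mono. Qed.

Lemma block_iter_turn m x i : i + m < p -> block (iter m turn x) i = block x (i + m).
Proof.
move=> imp; apply/setP=> j; rewrite !inE iter_turn; case: (x j) => [a|] //=.
rewrite !(inj_eq Some_inj) val_iter_ord_pred; last by lia.
have a_p := ltn_ord a; have [ma|am] := leqP m a.
  have -> : a + (p - m) = a - m + p by lia.
  by rewrite modnDr modn_small; lia.
by rewrite modn_small; lia.
Qed.

(** All the blocks have at least k elements. *)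
Definition large x := [forall i : 'I_p, k <= #|block x i|].

Lemma largeP x : reflect (forall i, i < p -> k <= #|block x i|) (large x).
Proof.
apply: (iffP forallP) => [xb i ip|xb i]; last exact: xb.
exact: (xb (Ordinal ip)).
Qed.

(** The iterated color set of the first p - 1 blocks. *)
Definition fcol x : P := spectrum k col p.-1 [::] (block x).
(** The iterated color sets of all the large vectors below x; there are none
    unless x is large. *)
Definition fcols x : {set P} := [set fcol y | y in [set y | large y && vle y x]].

Lemma fcol_turn x y : large y -> vle y x -> fcol x <> fcol (turn y).
Proof.
move=> /largeP yb yx; have p_gt1 := prime_gt1 p_pr.
have -> : fcol (turn y) = spectrum k col p.-1 [::] (fun i => block y i.+1).
  apply: eq_spectrum => i /andP[_ ip]; rewrite -addn1.
  by apply: (block_iter_turn (m := 1)); move: ip => /=; lia.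
have : 0 < #|[set a : {set 'I_n} | a \subset block y 0 & #|a| == k]|.
  by rewrite cards_draws bin_gt0 yb.
case/card_gt0P=> a; rewrite inE => /andP[ay ak].
apply: (@spectrum_proper p n k E col col_proper p.-1 [:: a]) => //=.
- by move=> i i' /andP[ii' _]; apply: block_disjoint; rewrite neq_ltn ii'.
- by move=> i _; apply: vle_block.
- by lia.
- by case=> // _; apply: subset_trans ay (vle_block _ yx).
by rewrite ak.
Qed.

Lemma fcols_mono x y : vle x y -> fcols x \subset fcols y.
Proof.
move=> /vleP xy; apply: imsetS; apply/subsetP=> z; rewrite !inE => /andP[-> /vleP zx].
by apply/vleP=> j a /zx /xy.
Qed.

Lemma vle_refl x : vle x x. Proof. exact/vleP. Qed.

(** The element [fcol x] of [fcols x] is missing from [fcols (turn x)], by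
    [fcol_turn]. *)
Lemma fcols_turn x : large x -> fcols x != fcols (turn x).
Proof.
move=> xb; have : fcol x \in fcols x.
  by apply/imsetP; exists x; rewrite // inE xb vle_refl.
apply: contraTneq => ->; apply/imsetP=> -[z]; rewrite inE => /andP[zb zx].
have [y ez] : exists y, z = turn y.
  by exists (iter p.-1 turn z); rewrite -iterS prednK // iter_turn_id.
have yx : vle y x.
  have turnK u : iter p.-1 turn (turn u) = u by rewrite -iterSr prednK // iter_turn_id.
  by rewrite -[x]turnK -[y]turnK -ez iter_turn_mono.
rewrite {}ez in zb *; apply: fcol_turn => //.
apply/largeP=> i ip; have [i0|i_gt0] := posnP i; last first.
  rewrite -(prednK i_gt0) -addn1 -(block_iter_turn (m := 1)); last by lia.
  by apply: (largeP _ zb); lia.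
have := largeP _ zb p.-1; rewrite prednK // => /(_ (leqnn _)).
congr (k <= _); apply: eq_card => j; rewrite !inE ffunE i0.
case: (y j) => [a|] //=; rewrite !(inj_eq Some_inj).
have a_p := ltn_ord a; have [a0|a_gt0] := posnP a.
  by rewrite a0 modn_small // ?eqxx; lia.
have -> : (a + p).-1 = a.-1 + p by lia.
by rewrite modnDr modn_small; lia.
Qed.

(** The set A, as long as it has fewer than k elements; otherwise only this
    fact is recorded, by the full set. *)
Definition cap (A : {set 'I_n}) := if k <= #|A| then setT else A.

Definition profile x : {set 'I_n} * {set P} := (cap (block x 0), fcols x).

(** The profiles of all the rotations of x. *)
Definition word x : {ffun 'I_p -> {set 'I_n} * {set P}} :=
  [ffun i : 'I_p => profile (iter i turn x)].

Definition rotate (w : {ffun 'I_p -> {set 'I_n} * {set P}}) :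
    {ffun 'I_p -> {set 'I_n} * {set P}} := [ffun i => w (ordS i)].

Lemma iter_rotate w : iter p rotate w = w.
Proof.
have itE m i : iter m rotate w i = w (iter m (@ordS p) i).
  by elim: m i => //= m IHm i; rewrite ffunE IHm -iterSr.
apply/ffunP=> i; rewrite itE; congr (w _).
have itK m (j : 'I_p) : iter m (@ord_pred p) (iter m (@ordS p) j) = j.
  by elim: m j => //= m IHm j; rewrite -[in RHS](IHm j) -iterS iterSr ordSK.
by rewrite -[RHS](itK p) iter_ord_pred_id.
Qed.

Lemma word_turn x : word (turn x) = rotate (word x).
Proof.
apply/ffunP=> i; rewrite !ffunE -iterSr /=.
have := ltn_ord i; rewrite leq_eqVlt => /orP[/eqP ip|ip].
  by rewrite ip modnn -iterS ip iter_turn_id.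
by rewrite modn_small.
Qed.

Lemma word_fixed x : rotate (word x) = word x ->
  forall m, profile (iter m turn x) = profile x.
Proof.
move=> fix_x; elim=> // m IHm.
have -> : profile (iter m.+1 turn x) = word (turn (iter m turn x)) z0.
  by rewrite ffunE.
have word_m : word (iter m turn x) = word x.
  by elim: m {IHm} => //= m IHm; rewrite word_turn IHm.
by rewrite word_turn word_m fix_x ffunE.
Qed.

(** The word of a nonzero vector is not constant: otherwise its blocks are all
    large, against [fcols_turn], or all equal, hence empty as p > 1. *)
Lemma word_not_fixed x : (exists j, x j != None) -> rotate (word x) != word x.
Proof.
case=> j0 xj0; apply/eqP=> /word_fixed fix_x.
have capx i : i < p -> cap (block x i) = cap (block x 0).
  by move=> ip; have [] := fix_x i; rewrite block_iter_turn ?add0n.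
have [big0|small0] := leqP k #|block x 0|.
  have xb : large x.
    apply/largeP=> i ip; have := capx i ip; rewrite /cap big0.
    by case: ifP => // small e; move: small; rewrite e cardsT card_ord; nia.
  by have [_ /esym/eqP] := fix_x 1; rewrite (negPf (fcols_turn xb)).
have same i : i < p -> block x i = block x 0.
  move=> ip; have := capx i ip; rewrite /cap (leqNgt k #|block x 0|) small0 /=.
  case: ifP => // _ e; move: small0; rewrite -e cardsT card_ord; nia.
have e10 := same 1 (prime_gt1 p_pr).
have := block_disjoint x (isT : 1 != 0); rewrite e10 -setI_eq0 setIid => /eqP empty.
case xj: (x j0) xj0 => [a|] // _.
have : j0 \in block x a by rewrite inE xj.
by rewrite same // empty inE.
Qed.

(** The contribution of one rotation y of a vector to its height: it is
    monotone in y, and on comparable vectors equal weights give equal profiles. *)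
Definition weight (y : T) := minn #|block y 0| k + #|fcols y|.
Definition height x := \sum_(i < p) weight (iter i turn x).

Lemma weight_mono x y : vle x y -> weight x <= weight y.
Proof.
move=> xy; apply: leq_add; last exact: subset_leq_card (fcols_mono xy).
rewrite leq_min geq_minr andbT; apply: leq_trans (geq_minl _ _) _.
exact: subset_leq_card (vle_block 0 xy).
Qed.

Lemma weight_eq_profile x y : vle x y -> weight x = weight y -> profile x = profile y.
Proof.
move=> xy; have sB := vle_block 0 xy; have sF := fcols_mono xy.
have cB := subset_leq_card sB; have cF := subset_leq_card sF.
rewrite /weight => e; congr (_, _); last by apply/eqP; rewrite eqEcard sF; lia.
rewrite /cap; case: (leqP k #|block x 0|) => kx.
  by rewrite (leq_trans kx cB).
case: (leqP k #|block y 0|) => ky; first by lia.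
by apply/eqP; rewrite eqEcard sB; lia.
Qed.

Lemma height_mono x y : vle x y -> height x <= height y.
Proof. by move=> xy; apply: leq_sum => i _; apply/weight_mono/iter_turn_mono. Qed.

(** On comparable vectors, equal heights force equal words, hence equal signs. *)
Lemma height_eq_word x y : vle x y -> height x = height y -> word x = word y.
Proof.
move=> xy e; apply/ffunP=> i; rewrite !ffunE; apply: weight_eq_profile.
  exact: iter_turn_mono.
have le_w j : weight (iter j turn x) <= weight (iter j turn y).
  exact/weight_mono/iter_turn_mono.
apply/eqP; rewrite eqn_leq le_w /= leqNgt; apply/negP=> lt_w.
suff : height x < height y by rewrite e ltnn.
rewrite /height (bigD1 i) //= [X in _ < X](bigD1 i) //= -addSn.
by apply: leq_add => //; apply: leq_sum.
Qed.

Lemma height_gt0 x : (exists j, x j != None) -> 0 < height x.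
Proof.
case=> j; case xj: (x j) => [a|] // _.
rewrite /height (bigD1 a) //= ltn_addr // /weight ltn_addr // leq_min k_gt0 andbT.
apply/card_gt0P; exists j.
by rewrite block_iter_turn ?add0n // inE xj.
Qed.

Lemma height_le x : height x <= p * k + p * #|P|.
Proof.
have <- : \sum_(i < p) (k + #|P|) = p * k + p * #|P|.
  by rewrite sum_nat_const card_ord mulnDr.
apply: leq_sum => i _.
by apply: leq_add; [exact: geq_minr | exact: max_card].
Qed.

(** The heights lie between 1 and p k + p |P|, and increase strictly along a
    chain of length n with alternating signs: n is too large for this. *)
Lemma proper_coloring_absurd : False.
Proof.
have [sgn sgnP] := equivariant_sign p_pr iter_rotate.
have belowP i x : below i x -> exists j, x j != None.
  by case/andP=> /existsP.
apply: (@alternating_chain p 'F_p T vle below n turn fill unitv (sgn \o word)) => //.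
- exact: pcharf0 (pchar_Fp p_pr).
- exact: iter_turn_id.
- exact: turn_mono.
- move=> i x /andP[/existsP[j xj] /forallP xi]; apply/andP; split.
    by apply/existsP; exists j; rewrite ffunE; case: (x j) xj.
  by apply/forallP=> l; have := xi l; rewrite ffunE; case: (x l).
- move=> i x /andP[_ /forallP xi]; apply/vleP=> j a xj; rewrite ffunE.
  by case: eqP => // ji; have := xi j; rewrite xj -ji leqnn.
- move=> i x y /vleP xy; apply/vleP=> j a; rewrite !ffunE; case: ifP => // _.
  exact: xy.
- move=> i x _; apply/vleP=> j a; rewrite !ffunE; case: ifP => //.
- move=> i x /andP[ex /forallP xi]; apply/andP; split=> //.
  by apply/forallP=> j; apply/implyP=> /ltnW; apply/implyP/xi.
- move=> i x i_n /andP[_ /forallP xi]; apply/andP; split.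
    by apply/existsP; exists (Ordinal i_n); rewrite ffunE /= eqxx.
  apply/forallP=> j; apply/implyP=> ij; rewrite ffunE gtn_eqF //=.
  by apply: (implyP (xi j)); apply: ltnW.
- move=> i i_n; apply/andP; split.
    by apply/existsP; exists (Ordinal i_n); rewrite ffunE /= eqxx.
  by apply/forallP=> j; apply/implyP=> ij; rewrite ffunE gtn_eqF.
- move=> i x /belowP x0 /=; rewrite word_turn; apply: sgnP.
  exact: word_not_fixed.
- by lia.
move=> l /and3P[/eqP szl lel Dl]; apply/negP=> altl.
have srt : sorted ltn (map height l).
  rewrite sorted_map; move: lel altl.
  case: l {szl Dl} => //= x l; elim: l x => //= y l IHl x /andP[xy ly] /andP[sxy altl].
  rewrite IHl // andbT ltn_neqAle height_mono // andbT.
  by apply: contraNneq sxy => /(height_eq_word xy) ->.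
have := uniq_leq_size (sorted_uniq ltn_trans ltnn srt) (s2 := iota 1 (p * k + p * #|P|)).
rewrite size_map szl size_iota => le_n.
suff /le_n : {subset map height l <= iota 1 (p * k + p * #|P|)} by lia.
move=> _ /mapP[x xl ->]; rewrite mem_iota add1n ltnS height_le andbT.
by apply: height_gt0; apply: belowP (allP Dl x xl).
Qed.

End Vectors.

(** * Kneser-shift graphs *)

(** The coloring is extended to arbitrary lists of sets by the extra color
    [None]. *)
Lemma monochromatic_edge p r n k (c : disj_tuple p.-1 n k -> 'I_r) :
    prime p -> 0 < k -> p * k + (p * #|iterset p.-1 (option 'I_r)|).+1 <= n ->
  exists A : disj_tuple p n k, c (init_tuple A) = c (tail_tuple A).
Proof.
move=> p_pr k_gt0 n_large.
have [/existsP[A /eqP eqA]|/existsPn proper_c] :=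
  boolP [exists A : disj_tuple p n k, c (init_tuple A) == c (tail_tuple A)].
  by exists A.
pose col (L : seq {set 'I_n}) : option 'I_r :=
  omap c (obind (insub : p.-1.-tuple {set 'I_n} -> option (disj_tuple p.-1 n k)) (insub L)).
have colE (A : disj_tuple p.-1 n k) : col (tval (val A)) = Some (c A).
  by rewrite /col valK /= valK.
case: (@proper_coloring_absurd p n k p_pr k_gt0 (option 'I_r) col) => // L szL disL.
have szL' : size L == p by apply/eqP.
pose A : disj_tuple p n k := exist (fun B => is_disj_tuple k (val B)) (Tuple szL') disL.
have := colE (init_tuple A); have := colE (tail_tuple A); rewrite /= => -> -> [e].
by have := proper_c A; rewrite e eqxx.
Qed.

(** Classical, as P is not assumed decidable. *)
Lemma least_exists (P : nat -> Prop) m : P m -> exists m', least P m'.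
Proof.
elim/ltn_ind: m => m IHm Pm.
have [[m' [lt_m' Pm']]|no_smaller] := classic (exists m', m' < m /\ P m').
  exact: IHm Pm'.
exists m; split=> // m' Pm'; rewrite leqNgt; apply/negP=> lt_m'.
by apply: no_smaller; exists m'.
Qed.

Theorem theorem4 (p : nat) (p_prime : prime p) :
  (forall M : nat, exists C : nat,
     forall (n k : nat) (n_gt0 : 0 < n) (k_gt0 : 0 < k),
       p * k + C <= n ->
       M <= chromatic_number (KSh n (prime_gt1 p_prime) k_gt0))
  /\
  (forall r : nat, exists C : nat,
     least (fun C : nat =>
       forall (n k : nat), 0 < n -> 0 < k -> p * k + C <= n ->
       forall c : disj_tuple p.-1 n k -> 'I_r,
       exists A : disj_tuple p n k, c (init_tuple A) = c (tail_tuple A)) C).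
Proof.
split=> [M|r]; last first.
  apply: (@least_exists _ (p * #|iterset p.-1 (option 'I_r)|).+1).
  by move=> n k _ k_gt0 n_large c; apply: monochromatic_edge.
exists (p * #|iterset p.-1 (option 'I_M)|).+1 => n k _ k_gt0 n_large.
rewrite /chromatic_number; case: ex_minnP => q /existsP[c /forallP c_proper] _.
rewrite leqNgt; apply/negP=> /ltnW q_le_M.
have [A eqA] := monochromatic_edge (fun u => widen_ord q_le_M (c u)) p_prime k_gt0 n_large.
have /implyP := forallP (c_proper (init_tuple A)) (tail_tuple A).
case/(_ _)/negP; first by apply/existsP; exists A; rewrite !eqxx.
by apply/eqP; apply: ord_inj; have /(congr1 (@nat_of_ord M)) := eqA.
Qed.
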